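(* Let $U,V\subset X^J$ and $\gamma:J\to\mathbb F$ with $\inf_{t\in J}|\gamma(t)|>0$. Assume that $$\limsup_{|t|\to\infty}\|u(t)\|\le\|u+\gamma v\|_\infty\qquad\text{for all }u\in U,\ v\in V,$$ that $U$ and $V$ are uniformly closed, and that $U-U\subset U$ and $V-V\subset V$. Assume moreover that one of the following three conditions holds: (a) $U\subset PS_+(J,X)$; (b) $V\subset PS_+(J,X)$ and $\|\gamma\|_\infty<\infty$; (c) $U+C_0(J,X)\subset U$, $V+C_0(J,X)\subset V$, $U,V\subset C(J,X)$, $\gamma\in C(J,\mathbb F)$, and $J$ is closed. Then $U+\gamma V$ is uniformly closed.
   Context: $X\neq\{0\}$ is a Banach space over $\mathbb F\in\{\mathbb R,\mathbb C\}$; $J$ is $[\alpha,\infty)$, $(\alpha,\infty)$ ($\alpha\in\mathbb R$) or $\mathbb R$. $\|f\|_\infty=\sup_{t\in J}\|f(t)\|\in[0,\infty]$. $\limsup_{|t|\to\infty}$ means $\limsup_{t\to\infty}$ if $J\ne\mathbb R$ and the maximum of the limsups as $t\to\pm\infty$ if $J=\mathbb R$. $U\pm V=\{u\pm v:u\in U,v\in V\}$, $\gamma V=\{\gamma v:v\in V\}$. $A\subset X^J$ is uniformly closed if $f_n\in A$, $f\in X^J$ and $f_n\to f$ uniformly on $J$ imply $f\in A$. $C(J,\cdot)$: continuous functions. $C_0(J,X)$: uniformly continuous functions $J\to X$ vanishing at infinity (as $t\to\infty$, and also as $t\to-\infty$ if $J=\mathbb R$). The class of Poisson stable functions $PS_+(J,X)$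 consists of all $f\in C(J,X)$ such that for each $n\in\mathbb N$ there is $\tau\in[n,\infty)$ with $\|f(t)-f(t+\tau)\|\le\frac1n$ for all $t\in J$ with $|t|\le n$. *)

(* Defs.v *)
From HB Require Import structures.
From mathcomp Require Import all_boot all_order all_algebra.
From mathcomp Require Import complex.
From mathcomp Require Import all_classical all_reals all_analysis.

Set Implicit Arguments.
Unset Strict Implicit.
Unset Printing Implicit Defensive.

Import Order.TTheory GRing.Theory Num.Theory.
Import numFieldNormedType.Exports.

Local Open Scope classical_set_scope.
Local Open Scope ring_scope.

Variant scalar_kind := RealScalars | ComplexScalars.

Definition scalars (R : realType) (k : scalar_kind) : numFieldType :=
  match k with
  | RealScalars => R
  | ComplexScalars => (R[i])%C
  end.

Definition re_scalar (R : realType) (k : scalar_kind) : scalars R k -> R :=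
  match k return scalars R k -> R with
  | RealScalars => id
  | ComplexScalars => @complex.Re R
  end.

(* The library norm of a normed space over F takes its values in F (in R[i],
   with zero imaginary part, when F is complex); this is the same number in R. *)
Definition rnorm (R : realType) (k : scalar_kind)
  (V : normedZmodType (scalars R k)) (x : V) : R := re_scalar `|x|.

Variant domain (R : realType) := ClosedRay of R | OpenRay of R | Line.
Arguments Line {R}.

Definition domain_set (R : realType) (J : domain R) : set R :=
  match J with
  | ClosedRay a => [set t | a <= t]
  | OpenRay a => [set t | a < t]
  | Line => setT
  end.

Coercion domain_set : domain >-> set.

Section domain_functions.
Context (R : realType) (k : scalar_kind) (J : domain R).
Local Notation F := (scalars R k).

Definition at_pinfty : set_system J :=
  subset_filter (pinfty_nbhs R) (fun t => t \in (J : set R)).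

(* Only meaningful when J is the whole line. *)
Definition at_ninfty : set_system J :=
  subset_filter (ninfty_nbhs R) (fun t => t \in (J : set R)).

Definition limsup_norm (V : normedZmodType F) (f : J -> V) : \bar R :=
  let g := fun t => (rnorm (f t))%:E in
  match J with
  | Line => maxe (limf_esup g at_pinfty) (limf_esup g at_ninfty)
  | _ => limf_esup g at_pinfty
  end.

Definition sup_norm (V : normedZmodType F) (f : J -> V) : \bar R :=
  ereal_sup [set (rnorm (f t))%:E | t in [set: J]].

Definition inf_norm (V : normedZmodType F) (f : J -> V) : \bar R :=
  ereal_inf [set (rnorm (f t))%:E | t in [set: J]].

Context (X : completeNormedModType F).
Implicit Types (A B : set (J -> X)) (f : J -> X) (g : J -> F).

Definition fadd A B : set (J -> X) :=
  [set h | exists2 u, A u & exists2 v, B v & h = (fun t => u t + v t)].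

Definition fsub A B : set (J -> X) :=
  [set h | exists2 u, A u & exists2 v, B v & h = (fun t => u t - v t)].

Definition fmul g A : set (J -> X) :=
  [set h | exists2 v, A v & h = (fun t => g t *: v t)].

Definition uniformly_closed A :=
  forall (f_ : nat -> J -> X) f,
    (forall n, A (f_ n)) -> {uniform, f_ @ \oo --> f} -> A f.

Definition C0 : set (J -> X) := [set f |
  [/\ unif_continuous f,
      f @ at_pinfty --> (0 : X) &
      (match J with Line => f @ at_ninfty --> (0 : X) | _ => True end)]].

(* J is stable under addition of tau >= 0, so the point s with
   value t + tau below exists and is unique. *)
Definition PS_plus : set (J -> X) := [set f |
  continuous f /\
  forall n : nat, (0 < n)%N ->
    exists2 tau : R, n%:R <= tau &
      forall t s : J, `|val t| <= n%:R -> val s = val t + tau ->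
        rnorm (f t - f s) <= n%:R^-1].

End domain_functions.

Arguments C0 {R k} J X.
Arguments PS_plus {R k} J X.

(* Main.v *)
Require Import Defs.
From HB Require Import structures.
From mathcomp Require Import all_boot all_order all_algebra.
From mathcomp Require Import complex.
From mathcomp Require Import all_classical all_reals all_analysis.
From mathcomp Require Import lra.

(** Why the sum is uniformly closed.

    Let [h_n = u_n + gamma v_n] converge uniformly to [h].  If both [u_n] and
    [v_n] are uniformly Cauchy, they have uniform limits [u] in [U] and [v] in
    [V], and [h = u + gamma v] pointwise ([fadd_fmul_cvg]).  Since [gamma] is
    bounded away from [0], [v_n] is uniformly Cauchy as soon as [u_n] is
    ([unif_cauchy_right]).  So everything is about making [u_n] or [v_n]
    uniformly Cauchy.

    [U] and [V] are stable under differences, so the hypothesis on the limsup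
    applies to [u_m - u_n] and [v_m - v_n]: near infinity, [u_m - u_n] is
    about as small as [h_m - h_n] is on the whole of [J] ([tail_difference]).
    It remains to control [u_m - u_n] far from infinity.

    A Poisson stable function is approximately repeated arbitrarily far to the
    right, so a bound valid near infinity is valid everywhere
    ([PS_plus_tail_bound]).  In case (a) this applies to [u_m - u_n].  In case
    (b) it applies to [v_m - v_n], because [gamma (v_m - v_n)] is small near
    infinity, being the difference of [h_m - h_n] and [u_m - u_n]; boundedness
    of [gamma] then carries the Cauchy property back to
    [u_n = h_n - gamma v_n].

    In case (c) the sequences are modified instead ([fadd_fmul_cvg_C0]).
    Along a subsequence with [|h - h_n| <= 2^-n], the step
    [w_n = u_(n+1) - u_n] is at most [3 * 2^-n] outside a bounded set, so for a
    suitable continuous cutoff [phi_n] of bounded support the function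
    [w_n - phi_n w_n] is at most [3 * 2^-n] everywhere.  Moving
    [p_n = phi_n w_n] from the left summand to the right one, that is taking
    [u'_n = u_n - \sum_(i < n) p_i] and
    [v'_n = v_n + \sum_(i < n) p_i / gamma], changes neither
    [u_n + gamma v_n] nor the membership in [U] and [V], since [p_i] and
    [p_i / gamma] lie in [C0]; and [u'_n] is uniformly Cauchy.  That [J] is
    closed makes these functions of bounded support uniformly continuous. *)

Set Implicit Arguments.
Unset Strict Implicit.
Unset Printing Implicit Defensive.

Import Order.TTheory GRing.Theory Num.Theory.
Import numFieldNormedType.Exports.

Local Open Scope classical_set_scope.
Local Open Scope ring_scope.

(** * Real-valued norms over either scalar field *)

Definition of_real (R : realType) (k : scalar_kind) : R -> scalars R k :=
  match k return R -> scalars R k with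
  | RealScalars => id
  | ComplexScalars => real_complex R
  end.

Section real_norm.
Context (R : realType) (k : scalar_kind).
Local Notation F := (scalars R k).
Local Notation ofR := (@of_real R k).

Lemma of_real_le (x y : R) : (ofR x <= ofR y) = (x <= y).
Proof. by rewrite /of_real; case: k => //=; rewrite lecR. Qed.

Lemma of_real_lt (x y : R) : (ofR x < ofR y) = (x < y).
Proof. by rewrite /of_real; case: k => //=; rewrite ltcR. Qed.

Lemma of_realD (x y : R) : ofR (x + y) = ofR x + ofR y.
Proof. by rewrite /of_real; case: k => //=; rewrite rmorphD. Qed.

Lemma of_realM (x y : R) : ofR (x * y) = ofR x * ofR y.
Proof. by rewrite /of_real; case: k => //=; rewrite rmorphM. Qed.

Lemma of_realN (x : R) : ofR (- x) = - ofR x.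
Proof. by rewrite /of_real; case: k => //=; rewrite rmorphN. Qed.

Lemma of_real0 : ofR 0 = 0.
Proof. by rewrite /of_real; case: k => //=; rewrite rmorph0. Qed.

Lemma of_real1 : ofR 1 = 1.
Proof. by rewrite /of_real; case: k => //=; rewrite rmorph1. Qed.

Lemma of_realK (x : R) : re_scalar (ofR x) = x.
Proof. by rewrite /of_real /re_scalar; case: k. Qed.

Lemma re_scalarK (x : F) : 0 <= x -> ofR (re_scalar x) = x.
Proof.
rewrite /of_real /re_scalar; case: k x => //= x x0.
by rewrite RRe_real // ger0_real.
Qed.

Lemma rnormE (V : normedZmodType F) (x : V) : `|x| = ofR (rnorm x).
Proof. by rewrite /rnorm re_scalarK. Qed.

Section normed.
Context (V : normedZmodType F).
Implicit Types x y : V.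

Lemma rnorm_ge0 x : 0 <= rnorm x.
Proof. by rewrite -of_real_le of_real0 -rnormE. Qed.

Lemma rnorm0 : rnorm (0 : V) = 0.
Proof. by rewrite /rnorm normr0 -of_real0 of_realK. Qed.

Lemma rnormN x : rnorm (- x) = rnorm x.
Proof. by rewrite /rnorm normrN. Qed.

Lemma rnormC x y : rnorm (x - y) = rnorm (y - x).
Proof. by rewrite /rnorm distrC. Qed.

Lemma rnormD x y : rnorm (x + y) <= rnorm x + rnorm y.
Proof. by rewrite -of_real_le of_realD -!rnormE ler_normD. Qed.

Lemma rnormB x y : rnorm (x - y) <= rnorm x + rnorm y.
Proof. by rewrite -(rnormN y) rnormD. Qed.

Lemma rnorm_triangle y x z : rnorm (x - z) <= rnorm (x - y) + rnorm (y - z).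
Proof. by rewrite (le_trans _ (rnormD _ _))// addrA subrK. Qed.

End normed.

Lemma rnormZ (V : normedModType F) (a : F) (x : V) :
  rnorm (a *: x) = rnorm a * rnorm x.
Proof.
by rewrite -[RHS](of_realK) of_realM -!rnormE -normrZ.
Qed.

Lemma rnorm_of_real (x : R) : rnorm (ofR x) = `|x|.
Proof.
wlog x0 : x / 0 <= x => [hw|].
  have [/hw//|/ltW x0] := leP 0 x.
  by rewrite -normrN -hw ?oppr_ge0// of_realN rnormN.
by rewrite /rnorm ger0_norm -?of_real0 ?of_real_le// of_realK ger0_norm.
Qed.

(** Together with [cvg_rnormP], this removes the scalar field from every later
    estimate: radii in [F] are replaced by radii in [R]. *)
Lemma entourage_rnormP (V : normedModType F) (E : set (V * V)) :
  entourage E <->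
  exists2 e : R, 0 < e & forall x y, rnorm (x - y) <= e -> E (x, y).
Proof.
rewrite -entourage_ballE; split=> [[e /= e0 He]|[e e0 He]].
  exists (re_scalar e / 2).
    by rewrite divr_gt0// -of_real_lt of_real0 re_scalarK// ltW.
  move=> x y xy; apply: He => /=; rewrite -ball_normE/= rnormE.
  rewrite -[ltRHS]re_scalarK ?ltW// of_real_lt (le_lt_trans xy)//.
  have : 0 < re_scalar e by rewrite -of_real_lt of_real0 re_scalarK// ltW.
  by lra.
exists (ofR e) => /=; first by rewrite -of_real0 of_real_lt.
move=> [x y]; rewrite /= -ball_normE/= rnormE of_real_lt => /ltW; exact: He.
Qed.

Lemma cvg_rnormP (V : normedModType F) (T : Type) (G : set_system T)
    {FG : Filter G} (f : T -> V) (y : V) :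
  f @ G --> y <->
  forall e : R, 0 < e -> \forall t \near G, rnorm (y - f t) <= e.
Proof.
split=> [/cvgrPdist_le fy e e0|fy].
  have := fy (ofR e); rewrite -of_real0 of_real_lt => /(_ e0).
  by apply: filterS => t; rewrite rnormE of_real_le.
apply/cvgrPdist_le => e e0.
have := fy (re_scalar e).
rewrite -of_real_lt of_real0 re_scalarK ?ltW// => /(_ e0).
by apply: filterS => t; rewrite rnormE -of_real_le re_scalarK// ltW.
Qed.

Lemma of_real_continuous : continuous ofR.
Proof.
move=> x; apply/(@cvg_rnormP F) => e e0.
have /cvgrPdist_le/(_ e e0) := @cvg_id _ (nbhs x).
by apply: filterS => y; rewrite -of_realN -of_realD rnorm_of_real.
Qed.

End real_norm.

(** * Uniform convergence and uniformly Cauchy sequences *)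

Section uniform_convergence.
Context (R : realType) (k : scalar_kind) (J : domain R).
Context (X : completeNormedModType (scalars R k)).
Local Notation F := (scalars R k).
Implicit Types (f g u v h : J -> X).

Definition unif_cauchy (f_ : nat -> J -> X) : Prop :=
  forall e : R, 0 < e -> exists N, forall m n, (N <= m)%N -> (N <= n)%N ->
    forall t, rnorm (f_ m t - f_ n t) <= e.

Lemma cvg_unifP (f_ : nat -> J -> X) f :
  {uniform, f_ @ \oo --> f} <->
  forall e : R, 0 < e -> exists N, forall n, (N <= n)%N ->
    forall t, rnorm (f t - f_ n t) <= e.
Proof.
split=> [ff e e0|ff].
  have /ff [N _ HN] : nbhs (f : {uniform J -> X})
      [set h | forall t, rnorm (f t - h t) <= e].
    apply/uniform_nbhs; exists [set xy | rnorm (xy.1 - xy.2) <= e]; split.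
      by apply/entourage_rnormP; exists e.
    by move=> h /= hf t; exact: hf.
  by exists N => n /HN.
move=> P /uniform_nbhs[E [/entourage_rnormP[e e0 eE] EP]].
have [N HN] := ff e e0.
by exists N => // n /= Nn; apply: EP => t _; apply: eE; exact: HN.
Qed.

Lemma cvg_unif_cauchy (f_ : nat -> J -> X) f :
  {uniform, f_ @ \oo --> f} -> unif_cauchy f_.
Proof.
move=> /cvg_unifP ff e e0.
have [|N HN] := ff (e / 2); first by rewrite divr_gt0.
exists N => m n Nm Nn t.
rewrite (le_trans (rnorm_triangle (f t) _ _))// [leRHS](splitr e) lerD ?HN//.
by rewrite rnormC HN.
Qed.

Lemma unif_cauchy_cvg (f_ : nat -> J -> X) : unif_cauchy f_ ->
  exists f, {uniform, f_ @ \oo --> f}.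
Proof.
move=> fC.
have ptw t : exists l : X, f_ ^~ t @ \oo --> l.
  apply/cvg_ex; apply: cauchy_cvg; apply: cauchy_exP => e e0.
  have [|N HN] := fC (re_scalar e / 2).
    by rewrite divr_gt0// -(of_real_lt k) of_real0 re_scalarK// ltW.
  exists (f_ N t), N => // n /= Nn; rewrite -ball_normE /= rnormE.
  rewrite -[ltRHS]re_scalarK ?ltW// of_real_lt (le_lt_trans (HN _ _ _ _ _))//.
  have : 0 < re_scalar e by rewrite -(of_real_lt k) of_real0 re_scalarK// ltW.
  by lra.
have [f ff] := choice ptw.
exists f; apply/cvg_unifP => e e0.
have [|N HN] := fC (e / 2); first by rewrite divr_gt0.
exists N => n Nn t.
have /cvg_rnormP/(_ (e / 2)) := ff t; rewrite divr_gt0// => /(_ isT)[M _ HM].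
rewrite (le_trans (rnorm_triangle (f_ (maxn M N) t) _ _))// [leRHS](splitr e).
by rewrite lerD ?HN ?leq_maxr//; apply: HM => /=; rewrite leq_maxl.
Qed.

Lemma unif_cauchyB (u_ v_ : nat -> J -> X) : unif_cauchy u_ -> unif_cauchy v_ ->
  unif_cauchy (fun n t => u_ n t - v_ n t).
Proof.
move=> uC vC e e0.
have [|N HN] := uC (e / 2); first by rewrite divr_gt0.
have [|M HM] := vC (e / 2); first by rewrite divr_gt0.
exists (maxn N M) => m n; rewrite !geq_max => /andP[Nm Mm] /andP[Nn Mn] t.
rewrite opprD addrACA -opprD (le_trans (rnormB _ _))// [leRHS](splitr e).
by rewrite lerD ?HN ?HM.
Qed.

Lemma unif_cauchyZ (c : J -> F) (M : R) (f_ : nat -> J -> X) :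
  (forall t, rnorm (c t) <= M) -> unif_cauchy f_ ->
  unif_cauchy (fun n t => c t *: f_ n t).
Proof.
move=> cM fC e e0.
(* A positive bound is needed to divide by, and [M] may be [0]. *)
have M1 : 0 < `|M| + 1 by rewrite ltr_wpDl.
have [|N HN] := fC (e / (`|M| + 1)); first by rewrite divr_gt0.
exists N => m n Nm Nn t; rewrite -scalerBr rnormZ.
rewrite -[leRHS](@divfK _ (`|M| + 1)) ?gt_eqF// mulrC ler_pM ?rnorm_ge0 ?HN//.
by rewrite (le_trans (cM t))// (le_trans (ler_norm _))// lerDl.
Qed.

Lemma cvg_unif_pointwise (f_ : nat -> J -> X) f t : {uniform, f_ @ \oo --> f} ->
  f_ ^~ t @ \oo --> f t.
Proof.
move=> /cvg_unifP ff; apply/cvg_rnormP => e e0.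
by have [N HN] := ff e e0; exists N => // n /HN.
Qed.

(** The limit is identified pointwise, because [gamma] may be unbounded and
    [gamma v_n] then need not obviously converge uniformly to [gamma v]. *)
Lemma fadd_fmul_cvg (gamma : J -> F) (U V : set (J -> X))
    (u_ v_ : nat -> J -> X) h :
  uniformly_closed U -> uniformly_closed V ->
  (forall n, U (u_ n)) -> (forall n, V (v_ n)) ->
  unif_cauchy u_ -> unif_cauchy v_ ->
  {uniform, (fun n t => u_ n t + gamma t *: v_ n t) @ \oo --> h} ->
  fadd U (fmul gamma V) h.
Proof.
move=> Ucl Vcl Uu Vv /unif_cauchy_cvg[u uu] /unif_cauchy_cvg[v vv] hh.
exists u; first exact: Ucl uu.
exists (fun t => gamma t *: v t); first by exists v => //; exact: Vcl vv.
apply/funext => t; have ht := cvg_unif_pointwise (t := t) hh.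
apply: (cvg_unique (@norm_hausdorff _ X) ht).
apply: cvgD; first exact: cvg_unif_pointwise uu.
by apply: cvgZ; [exact: cvg_cst|exact: cvg_unif_pointwise vv].
Qed.

End uniform_convergence.

(** * Behaviour at infinity and Poisson stability *)

Section asymptotics.
Context (R : realType) (k : scalar_kind) (J : domain R).
Local Notation F := (scalars R k).

Lemma domain_shift (t : J) (tau : R) : 0 <= tau ->
  exists s : J, val s = val t + tau.
Proof.
move=> tau0; have tJ : domain_set J (val t) by apply/set_mem/(valP t).
have sJ : domain_set J (val t + tau).
  case: J t tJ => [a|a|] t //= tJ; first by rewrite (le_trans tJ)// lerDl.
  by rewrite (lt_le_trans tJ)// lerDl.
by exists (exist (fun r => r \in (J : set R)) _ (mem_set sJ)).
Qed.

Lemma domain_bounded_below : J = Line \/ exists a, forall t : J, a <= val t.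
Proof.
case: J => [a|a|]; [right|right|by left]; exists a => t;
  have := set_mem (valP t) => //=; exact: ltW.
Qed.

Lemma sup_norm_le (V : normedZmodType F) (f : J -> V) (e : R) :
  (forall t, rnorm (f t) <= e) -> (sup_norm f <= e%:E)%E.
Proof. by move=> fe; apply: ub_ereal_sup => _ [t _ <-]; rewrite lee_fin. Qed.

Lemma sup_norm_lt_pinfty (V : normedZmodType F) (f : J -> V) :
  (sup_norm f < +oo)%E -> exists M : R, forall t, rnorm (f t) <= M.
Proof.
move=> foo; exists (fine (sup_norm f)) => t.
have ft : ((rnorm (f t))%:E <= sup_norm f)%E.
  by apply: ereal_sup_ubound; exists t.
rewrite -lee_fin fineK// fin_numE; apply/andP; split; last by rewrite lt_eqF.
by rewrite gt_eqF// (lt_le_trans _ ft)// ltNyr.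
Qed.

Lemma inf_norm_gt0 (V : normedZmodType F) (f : J -> V) :
  (0 < inf_norm f)%E -> exists2 c : R, 0 < c & forall t, c <= rnorm (f t).
Proof.
rewrite /inf_norm; set S := (X in ereal_inf X) => S0.
have lbS t : (ereal_inf S <= (rnorm (f t))%:E)%E.
  by apply: ereal_inf_lbound; exists t.
case: (ereal_inf S) S0 lbS => [c| |] //.
- by rewrite lte_fin => c0 cf; exists c => // t; rewrite -lee_fin.
- by move=> _ cf; exists 1 => // t; have := cf t; rewrite leye_eq.
Qed.

Lemma limf_esup_lt (T : choiceType) (X : filteredType T) (f : X -> R)
    (G : set_system X) (e : R) :
  (limf_esup (fun t => (f t)%:E) G < e%:E)%E ->
  exists2 A, G A & forall t, A t -> f t <= e.
Proof.
move=> /ereal_inf_lt[_ [A GA <-] Ae]; exists A => // t At.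
rewrite -lee_fin (le_trans _ (ltW Ae))//.
by apply: ereal_sup_ubound; exists t.
Qed.

Lemma at_pinfty_ge (A : set J) :
  at_pinfty A -> exists T : R, forall t : J, T <= val t -> A t.
Proof.
move=> [M [_ MA]]; exists (M + 1) => -[r rJ] /= Mr.
by apply: MA; rewrite (lt_le_trans _ Mr)// ltrDl.
Qed.

Lemma at_ninfty_le (A : set J) :
  at_ninfty A -> exists T : R, forall t : J, val t <= T -> A t.
Proof.
move=> [M [_ MA]]; exists (M - 1) => -[r rJ] /= Mr.
by apply: MA; rewrite (le_lt_trans Mr)// ltrBlDr ltrDl.
Qed.

(** Measuring tails by [`|val t|] treats all domains alike: on a ray the points
    with large absolute value are those near [+oo], once the threshold exceeds
    the absolute value of the endpoint. *)
Lemma limsup_norm_lt (V : normedZmodType F) (f : J -> V) (e : R) :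
  (limsup_norm f < e%:E)%E ->
  exists T : R, forall t : J, T <= `|val t| -> rnorm (f t) <= e.
Proof.
have tail : (limf_esup (fun t => (rnorm (f t))%:E) (@at_pinfty R J) < e%:E)%E ->
    exists T : R, forall t : J, T <= val t -> rnorm (f t) <= e.
  move=> /limf_esup_lt[A /at_pinfty_ge[T TA] Ae].
  by exists T => t /TA /Ae.
move=> fe.
have [T1 HT1] : exists T : R, forall t : J, T <= val t -> rnorm (f t) <= e.
  apply: tail; rewrite /limsup_norm in fe.
  by case: J f fe => [a|a|] f //=; rewrite gt_max => /andP[].
suff [T2 HT2] : exists T : R, forall t : J, val t <= T -> rnorm (f t) <= e.
  exists (Num.max T1 (- T2)) => t; rewrite ge_max.
  have [t0|t0] := leP 0 (val t).
    by rewrite ger0_norm// => /andP[+ _]; apply: HT1.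
  by rewrite ltr0_norm// lerN2 => /andP[_]; apply: HT2.
have [JL|[a aJ]] := domain_bounded_below; last first.
  (* No point of a ray lies to the left of [a - 1]. *)
  by exists (a - 1) => t; have := aJ t; lra.
have : (limf_esup (fun t => (rnorm (f t))%:E) (@at_ninfty R J) < e%:E)%E.
  by move: JL fe; rewrite /limsup_norm; case: J f {tail HT1} => //= f _;
    rewrite gt_max => /andP[].
by move=> /limf_esup_lt[A /at_ninfty_le[T TA] Ae]; exists T => t /TA /Ae.
Qed.

(** Given [t], Poisson stability provides [s = t + tau] in the tail with
    [f s] as close to [f t] as desired. *)
Lemma PS_plus_tail_bound (X : completeNormedModType F) (f : J -> X) (T e : R) :
  PS_plus J X f -> (forall t : J, T <= `|val t| -> rnorm (f t) <= e) ->
  forall t, rnorm (f t) <= e.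
Proof.
move=> [_ fPS] fT t; apply/ler_addgt0Pr => d d0.
(* [n] makes [1/n <= d], [`|t| <= n], and [t + tau] land beyond [T]. *)
pose n := (Num.truncn (Num.max d^-1 (`|T| + `|val t|))).+1.
have : Num.max d^-1 (`|T| + `|val t|) < n%:R by rewrite truncnS_gt.
rewrite gt_max => /andP[dn Tn].
have [//|tau ntau /(_ t)fn] := fPS n.
have tau0 : 0 <= tau by rewrite (le_trans _ ntau).
have [s st] := domain_shift t tau0.
rewrite -[f t](subrK (f s)) (le_trans (rnormD _ _))// addrC lerD//.
  apply: fT; rewrite st.
  have := ler_norm (val t + tau); have := ler_norm (- val t).
  by have := ler_norm T; rewrite normrN; lra.
rewrite (le_trans (fn s _ st))//; first by have := normr_ge0 T; lra.
by rewrite -[leRHS]invrK lef_pV2 ?posrE ?invr_gt0// ltW.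
Qed.

End asymptotics.

(** * Cutoffs and continuous functions of bounded support *)

Section cutoffs.
Context (R : realType) (k : scalar_kind) (J : domain R).
Local Notation F := (scalars R k).
Context (X : completeNormedModType F).

Lemma continuous_rnorm (f : J -> X) (t : J) : {for t, continuous f} ->
  forall e : R, 0 < e -> exists2 d : R, 0 < d &
    forall s : J, `|val t - val s| < d -> rnorm (f t - f s) <= e.
Proof.
move=> /cvg_rnormP ft e e0.
have /nbhs_ballP[d d0 dA] := ft e e0.
by exists d => // s ts; exact: dA.
Qed.

(** Heine-Cantor.  Compactness is used in [R], for the intersection of [J] with
    a segment, and closedness of [J] is what makes that intersection compact. *)
Lemma compact_support_unif_continuous (f : J -> X) (M : R) :
  closed (J : set R) -> continuous f ->
  (forall t, M <= `|val t| -> f t = 0) -> unif_continuous f.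
Proof.
move=> Jcl fc fM E /entourage_rnormP[e e0 eE].
(* The margin [1] ensures that two points at distance less than [1], one of
   which lies outside [[- L, L]], both lie where [f] vanishes. *)
pose L : R := `|M| + 1.
pose P (d r : R) := forall s t : J, `|r - val s| < d -> `|r - val t| < d ->
  rnorm (f s - f t) <= e.
have cK : compact (`[- L, L]%classic `&` (J : set R)).
  exact/compact_closedI/Jcl/segment_compact.
have [d d0 [d1 dP]] : exists2 d : R, 0 < d & d <= 1 /\
    forall r, `|r| <= L -> (J : set R) r -> P d r.
  have KP : \forall d \near 0^'+, `[- L, L]%classic `&` (J : set R) `<=` P d.
    apply: (near_covering_withinP _).2; first exact/compact_near_coveringP.
    move=> r [_ rJ].
    pose x : J := exist (fun r => r \in (J : set R)) r (mem_set rJ).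
    have [d d0 xd] := continuous_rnorm (fc x) (divr_gt0 e0 (@ltr0Sn R 1)).
    have d20 : 0 < d / 2 by rewrite divr_gt0.
    exists (ball r (d / 2), [set a | a < d / 2]).
      by split; [exact: nbhsx_ballx|exact: nbhs_right_lt].
    move=> [r' a]/= [rr' ad] _ s t r's r't.
    rewrite (le_trans (rnorm_triangle (f x) _ _))// [leRHS](splitr e) lerD//.
      rewrite rnormC xd//= [ltRHS]splitr (le_lt_trans (ler_distD r' _ _))//.
      by rewrite ltrD// (lt_trans r's).
    rewrite xd//= [ltRHS]splitr (le_lt_trans (ler_distD r' _ _))//.
    by rewrite ltrD// (lt_trans r't).
  near (0:R)^'+ => d; exists d => //; split.
    by near: d; exact: nbhs_right_ltW.
  move=> r rL rJ; apply: (near KP d) => //; split=> //=.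
  by rewrite in_itv/= -ler_norml.
rewrite /= /nbhs/= -entourage_ballE; exists d => //= -[s t] /=.
change (`|val s - val t| < d -> E (f s, f t)) => std.
apply: eE => /=.
have [sL|sL] := leP `|val s| L.
  apply: (dP (val s)) => //; last by rewrite subrr normr0.
  exact/set_mem/(valP s).
have tL : M <= `|val t|.
  have := ler_norm M; have := lerB_dist (val s) (val t).
  by rewrite /L in sL; lra.
have sM : M <= `|val s|.
  have := ler_norm M; by rewrite /L in sL; lra.
by rewrite !fM// subr0 rnorm0 ltW.
Unshelve. all: by end_near. Qed.

Lemma compact_support_C0 (f : J -> X) (M : R) :
  closed (J : set R) -> continuous f ->
  (forall t, M <= `|val t| -> f t = 0) -> C0 J X f.
Proof.
move=> Jcl fc fM.
split; first exact: compact_support_unif_continuous fM.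
  move=> A /nbhs_singleton A0; exists M; split; first exact: num_real.
  by move=> r Mr rJ /=; rewrite fM//= (le_trans (ltW Mr))// ler_norm.
have ninfty : f @ @at_ninfty R J --> (0 : X).
  move=> A /nbhs_singleton A0; exists (- M); split; first exact: num_real.
  move=> r Mr rJ /=; rewrite fM//= -normrN (le_trans _ (ler_norm _))//.
  by rewrite lerNr ltW.
by case: J f ninfty {fc fM Jcl} => //.
Qed.

Definition cutoff (T : R) (t : J) : F :=
  of_real k (Num.max 0 (Num.min 1 (T + 1 - `|val t|))).

Lemma cutoff_continuous T : continuous (cutoff T).
Proof.
pose h (r : R) : R := Num.max 0 (Num.min 1 (T + 1 - `|r|)).
have hc : continuous h.
  move=> r.
  apply: (@continuous_max _ _ (fun=> 0) (fun r => Num.min 1 (T + 1 - `|r|))).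
    exact: cvg_cst.
  apply: (@continuous_min _ _ (fun=> 1) (fun r => T + 1 - `|r|)).
    exact: cvg_cst.
  apply: cvgB; first exact: cvg_cst.
  exact: (@norm_continuous R R^o).
have valc : continuous (@set_val _ (J : set R)) by exact: initial_continuous.
move=> t; have hvc := continuous_comp (valc t) (hc _).
exact: (continuous_comp hvc (@of_real_continuous R k _)).
Qed.

Lemma cutoff_eq0 T t : T + 1 <= `|val t| -> cutoff T t = 0.
Proof.
move=> Tt; rewrite /cutoff -(of_real0 R k); congr of_real.
by apply/max_idPl; rewrite ge_min subr_le0 Tt orbT.
Qed.

Lemma cutoff_eq1 T t : `|val t| <= T -> cutoff T t = 1.
Proof.
move=> Tt; rewrite /cutoff -(of_real1 R k); congr of_real.
by rewrite min_l ?max_r// lerBrDr addrC lerD2r.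
Qed.

Lemma cutoff_tail (T e : R) (f : J -> X) t : 0 <= e ->
  (T <= `|val t| -> rnorm (f t) <= e) -> rnorm (f t - cutoff T t *: f t) <= e.
Proof.
move=> e0 fe; have [tT|tT] := leP `|val t| T.
  by rewrite cutoff_eq1// scale1r subrr rnorm0.
rewrite -[X in rnorm (X - _)]scale1r -scalerBl rnormZ.
rewrite -[leRHS]mul1r ler_pM ?rnorm_ge0 ?(fe (ltW tT))//.
rewrite /cutoff -(of_real1 R k) -of_realN -of_realD rnorm_of_real.
set m := Num.max _ _; have m0 : 0 <= m by rewrite le_max lexx.
have m1 : m <= 1 by rewrite ge_max ler01 ge_min lexx.
by rewrite ger0_norm ?subr_ge0// gerBl.
Qed.

End cutoffs.

(** * Uniform closedness of the sum *)

Section closed_sums.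
Context (R : realType) (k : scalar_kind) (J : domain R).
Local Notation F := (scalars R k).
Context (X : completeNormedModType F).
Implicit Types (U V : set (J -> X)) (u v h : J -> X).

Lemma rnormV_le (a : F) (c : R) : 0 < c -> c <= rnorm a -> rnorm a^-1 <= c^-1.
Proof.
move=> c0 ca; have a0 : 0 < rnorm a by exact: lt_le_trans ca.
have -> : rnorm a^-1 = (rnorm a)^-1.
  apply: (mulIf (lt0r_neq0 a0)); rewrite mulVf ?gt_eqF//.
  rewrite -[LHS](of_realK k) of_realM -!rnormE -normrM mulVf ?normr1.
    by rewrite -of_real1 of_realK.
  by rewrite -normr_gt0 rnormE -of_real0 of_real_lt.
by rewrite lef_pV2.
Qed.

Lemma rnorm_neq0 (a : F) (c : R) : 0 < c -> c <= rnorm a -> a != 0.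
Proof.
move=> c0 ca; rewrite -normr_gt0 rnormE -of_real0 of_real_lt.
exact: lt_le_trans ca.
Qed.

Lemma fsubW U u v : fsub U U `<=` U -> U u -> U v -> U (fun t => u t - v t).
Proof. by move=> UU Uu Uv; apply: UU; exists u => //; exists v. Qed.

(** The only way the limsup hypothesis is used: it is applied to the difference
    of two elements of the sum. *)
Lemma tail_difference U V (gamma : J -> F)
    (limsup_le : forall u v, U u -> V v ->
      (limsup_norm u <= sup_norm (fun t => u t + gamma t *: v t)%R)%E)
    (UU : fsub U U `<=` U) (VV : fsub V V `<=` V)
    u u' v v' (d e : R) : U u -> U u' -> V v -> V v' -> d < e ->
  (forall t, rnorm ((u t + gamma t *: v t) - (u' t + gamma t *: v' t)) <= d) ->
  exists T : R, forall t : J, T <= `|val t| -> rnorm (u t - u' t) <= e.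
Proof.
move=> Uu Uu' Vv Vv' de hd; apply: limsup_norm_lt.
apply: le_lt_trans (_ : (d%:E < e%:E)%E); last by rewrite lte_fin.
apply: le_trans (limsup_le _ _ (fsubW UU Uu Uu') (fsubW VV Vv Vv')) _.
by apply: sup_norm_le => t; rewrite scalerBr addrACA -opprD.
Qed.

Section sequences.
Context (U V : set (J -> X)) (gamma : J -> F) (c : R) (c0 : 0 < c).
Context (c_gamma : forall t, c <= rnorm (gamma t)).
Context (limsup_le : forall u v, U u -> V v ->
  (limsup_norm u <= sup_norm (fun t => u t + gamma t *: v t)%R)%E).
Context (U_closed : uniformly_closed U) (V_closed : uniformly_closed V).
Context (UU : fsub U U `<=` U) (VV : fsub V V `<=` V).
Context (u_ v_ : nat -> J -> X) (h : J -> X).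
Context (Uu : forall n, U (u_ n)) (Vv : forall n, V (v_ n)).
Let h_ n t := u_ n t + gamma t *: v_ n t.

Lemma unif_cauchy_right (a b : nat -> J -> X) : unif_cauchy a ->
  unif_cauchy (fun n t => a n t + gamma t *: b n t) -> unif_cauchy b.
Proof.
move=> aC abC.
have -> : b = fun n t => (gamma t)^-1 *: (a n t + gamma t *: b n t - a n t).
  apply/funext => n; apply/funext => t.
  rewrite addrC addKr scalerA mulVf ?scale1r//.
  exact: rnorm_neq0 (c_gamma t).
apply: (@unif_cauchyZ _ _ _ _ _ c^-1); last exact: unif_cauchyB.
by move=> t; exact: rnormV_le.
Qed.

Lemma fadd_fmul_cvg_PS_left : U `<=` PS_plus J X ->
  {uniform, h_ @ \oo --> h} -> fadd U (fmul gamma V) h.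
Proof.
move=> UPS hh; have hC := cvg_unif_cauchy hh.
have uC : unif_cauchy u_.
  move=> e e0; have [|N HN] := hC (e / 2); first by rewrite divr_gt0.
  exists N => m n Nm Nn.
  have [|T HT] := tail_difference limsup_le UU VV (Uu m) (Uu n) (Vv m) (Vv n)
    (d := e / 2) (e := e) _ (HN m n Nm Nn); first by lra.
  exact: (PS_plus_tail_bound (UPS _ (fsubW UU (Uu m) (Uu n))) HT).
exact: (fadd_fmul_cvg U_closed V_closed Uu Vv uC (unif_cauchy_right uC hC) hh).
Qed.

Lemma fadd_fmul_cvg_PS_right (M : R) : V `<=` PS_plus J X ->
  (forall t, rnorm (gamma t) <= M) ->
  {uniform, h_ @ \oo --> h} -> fadd U (fmul gamma V) h.
Proof.
move=> VPS gammaM hh; have hC := cvg_unif_cauchy hh.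
have vC : unif_cauchy v_.
  move=> e e0; have ce : 0 < c * e / 3 by rewrite divr_gt0// mulr_gt0.
  have [N HN] := hC _ ce.
  exists N => m n Nm Nn.
  have [|T HT] := tail_difference limsup_le UU VV (Uu m) (Uu n) (Vv m) (Vv n)
    (d := c * e / 3) (e := c * e / 2) _ (HN m n Nm Nn); first by lra.
  apply: (PS_plus_tail_bound (VPS _ (fsubW VV (Vv m) (Vv n))) (T := T)) => t Tt.
  rewrite -(ler_pM2l c0).
  apply: le_trans (ler_wpM2r (rnorm_ge0 _) (c_gamma t)) _.
  rewrite -rnormZ scalerBr.
  have -> : gamma t *: v_ m t - gamma t *: v_ n t =
      (h_ m t - h_ n t) - (u_ m t - u_ n t).
    by rewrite /h_ [u_ m t + _]addrC [u_ n t + _]addrC opprD addrACA addrK.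
  have := rnormB (h_ m t - h_ n t) (u_ m t - u_ n t).
  have := HN m n Nm Nn t; have := HT t Tt; lra.
have uC : unif_cauchy u_.
  have -> : u_ = fun n t => h_ n t - gamma t *: v_ n t.
    by apply/funext => n; apply/funext => t; rewrite /h_ addrK.
  by apply: unif_cauchyB => //; exact: unif_cauchyZ gammaM vC.
exact: (fadd_fmul_cvg U_closed V_closed Uu Vv uC vC hh).
Qed.

End sequences.

Lemma geometric_le (e : R) : 0 < e -> exists n, 2^-1 ^+ n <= e.
Proof.
move=> e0; exists (Num.truncn e^-1).+1.
rewrite -[leRHS]invrK exprVn lef_pV2 ?posrE ?invr_gt0 ?exprn_gt0//.
rewrite (le_trans (ltW (truncnS_gt _)))// -natrX ler_nat ltnW//.
exact: ltn_expl.
Qed.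

(** Telescoping: with steps at most [M / 2^n] the distance between the terms
    of ranks [n] and [n + d] is at most [2 M (1 / 2^n - 1 / 2^(n + d))], a
    bound that is stable under induction on [d]. *)
Lemma unif_cauchy_geometric (f_ : nat -> J -> X) (M : R) : 0 < M ->
  (forall n t, rnorm (f_ n.+1 t - f_ n t) <= M * 2^-1 ^+ n) -> unif_cauchy f_.
Proof.
move=> M0 fM.
have step n d t :
    rnorm (f_ (n + d)%N t - f_ n t) <= 2 * M * (2^-1 ^+ n - 2^-1 ^+ (n + d)).
  elim: d => [|d IH]; first by rewrite addn0 !subrr rnorm0 mulr0.
  rewrite addnS (le_trans (rnorm_triangle (f_ (n + d)%N t) _ _))//.
  rewrite (le_trans (lerD (fM _ _) IH))// exprS.
  have : 0 <= 2^-1 ^+ (n + d) :> R by rewrite exprn_ge0.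
  by move: (_ ^+ (n + d)) => x x0; lra.
move=> e e0.
have [|N HN] := geometric_le (e := e / (4 * M)).
  by rewrite divr_gt0// mulr_gt0.
have tail n t : (N <= n)%N -> rnorm (f_ n t - f_ N t) <= e / 2.
  move=> Nn; rewrite -(subnKC Nn) (le_trans (step _ _ _))//.
  rewrite ler_pdivlMr ?mulr_gt0// in HN.
  have : 0 <= 2^-1 ^+ (N + (n - N)) * M by rewrite mulr_ge0 ?exprn_ge0// ltW.
  by move: (_ ^+ (N + _)) (_ ^+ N) HN => x y; lra.
exists N => m n Nm Nn t.
rewrite (le_trans (rnorm_triangle (f_ N t) _ _))// [leRHS](splitr e).
by rewrite lerD ?tail// rnormC tail.
Qed.

Lemma fadd_C0_sum U u (g : nat -> J -> X) n : fadd U (C0 J X) `<=` U ->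
  (forall i, C0 J X (g i)) -> U u -> U (fun t => u t + \sum_(i < n) g i t).
Proof.
move=> UC gC Uu; elim: n => [|n IH].
  by under eq_fun do rewrite big_ord0 addr0.
under eq_fun do rewrite big_ord_recr /= addrA.
by apply: UC; exists (fun t => u t + \sum_(i < n) g i t) => //; exists (g n).
Qed.

(** Case (c), along a sequence that converges at a geometric rate.  The bounded
    parts [p n] of the steps of [u_] are transferred to the other summand. *)
Lemma fadd_fmul_cvg_C0 U V (gamma : J -> F) (c : R) (u_ v_ : nat -> J -> X) h
    (c0 : 0 < c) (c_gamma : forall t, c <= rnorm (gamma t))
    (limsup_le : forall u v, U u -> V v ->
      (limsup_norm u <= sup_norm (fun t => u t + gamma t *: v t)%R)%E)
    (U_closed : uniformly_closed U) (V_closed : uniformly_closed V)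
    (UU : fsub U U `<=` U) (VV : fsub V V `<=` V)
    (Uu : forall n, U (u_ n)) (Vv : forall n, V (v_ n)) :
  fadd U (C0 J X) `<=` U -> fadd V (C0 J X) `<=` V ->
  (forall u, U u -> continuous u) -> continuous gamma -> closed (J : set R) ->
  (forall n t, rnorm (h t - (u_ n t + gamma t *: v_ n t)) <= 2^-1 ^+ n) ->
  fadd U (fmul gamma V) h.
Proof.
move=> UC VC Uc gammac Jcl hrate.
pose w n t := u_ n.+1 t - u_ n t.
have w_tail n : exists T : R, forall t : J,
    T <= `|val t| -> rnorm (w n t) <= 3 * 2^-1 ^+ n.
  have x0 : 0 < 2^-1 ^+ n :> R by rewrite exprn_gt0.
  (* The steps of [u_ + gamma v_] are at most [2^-n + 2^-(n+1)]; [2] leaves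
     room below the strict bound [3]. *)
  apply: (tail_difference limsup_le UU VV (Uu n.+1) (Uu n) (Vv n.+1) (Vv n)
    (d := 2 * 2^-1 ^+ n)); first by lra.
  move=> t; apply: le_trans (rnorm_triangle (h t) _ _) _.
  rewrite rnormC; have := hrate n.+1 t; have := hrate n t.
  by rewrite exprS; move: x0; lra.
have [T HT] := choice w_tail.
have wc n : continuous (w n) by apply: Uc; exact: fsubW.
pose p n t := cutoff k (T n) t *: w n t.
have pC n (a : J -> F) : continuous a -> C0 J X (fun t => a t *: p n t).
  move=> ac; apply: (compact_support_C0 (M := T n + 1)) => //.
    move=> t; apply: (continuousZ (ac t)).
    by apply: continuousZ; [exact: cutoff_continuous|exact: wc].
  by move=> t tT; rewrite /p cutoff_eq0// scale0r scaler0.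
have gamma0 t : gamma t != 0 by exact: rnorm_neq0 (c_gamma t).
pose u' n t := u_ n t + \sum_(i < n) (- 1) *: p i t.
pose v' n t := v_ n t + \sum_(i < n) (gamma t)^-1 *: p i t.
have h'E n t : u' n t + gamma t *: v' n t = u_ n t + gamma t *: v_ n t.
  rewrite /u' /v' scalerDr -!scaler_sumr scalerA divff// scaleN1r scale1r.
  by rewrite addrACA addNr addr0.
have h'h : {uniform, (fun n t => u' n t + gamma t *: v' n t) @ \oo --> h}.
  apply/cvg_unifP => e e0; have [N HN] := geometric_le e0.
  exists N => n Nn t; rewrite h'E (le_trans (hrate n t))// (le_trans _ HN)//.
  by rewrite ler_wiXn2l// invf_le1// ler1n.
have u'C : unif_cauchy u'.
  apply: (@unif_cauchy_geometric _ 3) => // n t.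
  have -> : u' n.+1 t - u' n t = w n t - cutoff k (T n) t *: w n t.
    rewrite /u' big_ord_recr/= scaleN1r opprD addrACA -/(w n t).
    by rewrite [_ + - p n t]addrC addrK.
  by apply: cutoff_tail; [rewrite mulr_ge0// exprn_ge0|exact: HT].
have v'C := unif_cauchy_right c0 c_gamma u'C (cvg_unif_cauchy h'h).
apply: (fadd_fmul_cvg U_closed V_closed _ _ u'C v'C h'h) => n.
  apply: (fadd_C0_sum (g := fun i t => (- 1) *: p i t) n UC _ (Uu n)) => i.
  by apply: (pC i (fun=> - 1)); exact: cst_continuous.
apply: (fadd_C0_sum (g := fun i t => (gamma t)^-1 *: p i t) n VC _ (Vv n)) => i.
apply: (pC i (fun t => (gamma t)^-1)) => t.
by apply: continuousV; [exact: gamma0|exact: gammac].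
Qed.

End closed_sums.

Theorem theorem5p9 (R : realType) (k : scalar_kind)
  (X : completeNormedModType (scalars R k)) (X_neq0 : exists x : X, x != 0)
  (J : domain R) (U V : set (J -> X)) (gamma : J -> scalars R k)
  (gamma_inf : (0 < inf_norm gamma)%E)
  (limsup_le : forall u v, U u -> V v ->
     (limsup_norm u <= sup_norm (fun t => u t + gamma t *: v t)%R)%E)
  (U_closed : uniformly_closed U) (V_closed : uniformly_closed V)
  (U_sub : fsub U U `<=` U) (V_sub : fsub V V `<=` V)
  (habc :
     U `<=` PS_plus J X
     \/ (V `<=` PS_plus J X /\ (sup_norm gamma < +oo)%E)
     \/ [/\ fadd U (C0 J X) `<=` U, fadd V (C0 J X) `<=` V,
            (forall u, U u -> continuous u) /\ (forall v, V v -> continuous v),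
            continuous gamma &
            closed (J : set R)]) :
  uniformly_closed (fadd U (fmul gamma V)).
Proof.
have [c c0 c_gamma] := inf_norm_gt0 gamma_inf.
move=> h_ h Hh hh.
have /choice[uv Huv] n : exists p : (J -> X) * (J -> X),
    [/\ U p.1, V p.2 & h_ n = fun t => p.1 t + gamma t *: p.2 t].
  by have [u Uu [_ [v Vv ->] ->]] := Hh n; exists (u, v).
have Uu n : U (uv n).1 by have [] := Huv n.
have Vv n : V (uv n).2 by have [] := Huv n.
have h_E : h_ = fun n t => (uv n).1 t + gamma t *: (uv n).2 t.
  by apply/funext => n; have [] := Huv n.
rewrite {}h_E {Huv Hh} in hh.
have [UPS|[[VPS /sup_norm_lt_pinfty[M gammaM]]|]] := habc.
- exact: (fadd_fmul_cvg_PS_left c0 c_gamma limsup_le U_closed V_closed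
    U_sub V_sub Uu Vv UPS hh).
- exact: (fadd_fmul_cvg_PS_right c0 c_gamma limsup_le U_closed V_closed
    U_sub V_sub Uu Vv VPS gammaM hh).
move=> [UC VC [Uc _] gammac Jcl].
have /choice[N HN] n : exists N, forall t,
    rnorm (h t - ((uv N).1 t + gamma t *: (uv N).2 t)) <= 2^-1 ^+ n.
  have /cvg_unifP/(_ (2^-1 ^+ n)) := hh; rewrite exprn_gt0// => /(_ isT)[N HN].
  by exists N; exact: HN.
exact: (fadd_fmul_cvg_C0 c0 c_gamma limsup_le U_closed V_closed U_sub V_sub
  (fun n => Uu (N n)) (fun n => Vv (N n)) UC VC Uc gammac Jcl HN).
Qed.
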